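(* Let $A=\mathbb C[z_1^{\pm1},\dots,z_m^{\pm1},1/R(z)]$ and let $\widetilde{\mathcal I}^*$ be the ideal of $A[\xi_1,\dots,\xi_m]$ generated by $$\widetilde L_k=(z_k\xi_k)^p-z_k^p\Big(\sum_{j=1}^m z_j\xi_j\Big)^p,\qquad k=1,\dots,m.$$ Then $A[\xi_1,\dots,\xi_m]/\widetilde{\mathcal I}^*$ is a locally free $A$-module of rank $p^m$.
   Context: $R(z)=\prod_{(i_1,\dots,i_m)\in\{1,\dots,p\}^m}(1-\zeta_p^{i_1}z_1-\cdots-\zeta_p^{i_m}z_m)$, $\zeta_p=\exp(2\pi\sqrt{-1}/p)$, $p\ge2$, $m\ge1$. *)

(* Defs.v *)
From HB Require Import structures.
From mathcomp Require Import all_boot all_order all_algebra.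
From mathcomp Require Import fraction.
From mathcomp Require Import complex.
From mathcomp Require Import boolp reals.
From mathcomp Require trigo.
From mathcomp Require Import mpoly.
Set Implicit Arguments. Unset Strict Implicit. Unset Printing Implicit Defensive.
Import Order.TTheory GRing.Theory Num.Theory.
Local Open Scope ring_scope.

(* For a commutative ring A, an A-module V and a submodule S of V (given as  *)
(* a predicate), [locally_free_quot S r] says that M := V/S is a (finite)    *)
(* locally free A-module of rank r: there are f_1..f_n in A generating the   *)
(* unit ideal such that each localization M_{f_i} is a free A_{f_i}-module   *)
(* of rank r.  The localization M_f is written out explicitly: M_f is free   *)
(* with basis e_1/1, ..., e_r/1 (any basis of M_f can be rescaled by the     *)
(* units f^k to this form) iff                                               *)
(*  - generation: every x in M satisfies f^N x = sum_j c_j e_j in M, and     *)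
(*  - independence: sum_j c_j e_j = 0 in M implies f^N c_j = 0 for all j.    *)
Definition locally_free_quot (A : comNzRingType) (V : lmodType A)
    (S : V -> Prop) (r : nat) : Prop :=
  exists (n : nat) (f a : 'I_n -> A),
    \sum_(i < n) a i * f i = 1 /\
    forall i : 'I_n, exists e : 'I_r -> V,
      (forall x : V, exists (N : nat) (c : 'I_r -> A),
          S (f i ^+ N *: x - \sum_(j < r) c j *: e j)) /\
      (forall c : 'I_r -> A, S (\sum_(j < r) c j *: e j) ->
          exists N : nat, forall j : 'I_r, f i ^+ N * c j = 0).

Section Setting.
Variables (R : realType) (m p : nat).

Local Notation C := (R[i]).
Local Notation P := {mpoly C[m]}.

Definition zeta : C :=
  Complex (trigo.cos (2 * trigo.pi / p%:R)) (trigo.sin (2 * trigo.pi / p%:R)).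

(* R(z) = prod_{(i_1..i_m) in {1..p}^m} (1 - zeta^{i_1} z_1 - ... - zeta^{i_m} z_m);
   the index i_j in {1,..,p} is represented by (t j).+1 with t j : 'I_p. *)
Definition Rpoly : P :=
  \prod_(t : {ffun 'I_m -> 'I_p})
     (1 - \sum_(j < m) (zeta ^+ (t j).+1)%:MP * 'X_j).

(* The element inverted in A = C[z^{+-1}, 1/R]: z_1 ... z_m R(z). *)
Definition Dpoly : P := (\prod_(j < m) 'X_j) * Rpoly.

Definition Fz := {fraction P}.
Local Notation "x %:F" := (@FracField.tofrac P x).

(* A = C[z_1^{+-1},...,z_m^{+-1}, 1/R(z)] as a subring of Frac(C[z]). *)
Definition Apred : {pred Fz} :=
  fun x => `[< exists (N : nat) (Q : P), x * (Dpoly ^+ N)%:F = Q%:F >].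

Lemma Apred_subring : subring_closed Apred.
Proof.
split.
- apply/asboolP; exists 0%N, 1; by rewrite expr0 mul1r rmorph1.
- move=> x y /asboolP [N [Q hQ]] /asboolP [M [Q' hQ']].
  apply/asboolP; exists (N + M)%N, (Q * Dpoly ^+ M - Q' * Dpoly ^+ N).
  rewrite rmorphB !rmorphM /= -hQ -hQ' exprD rmorphM /=.
  rewrite mulrBl; congr (_ - _); first by rewrite mulrA.
  by rewrite [(Dpoly ^+ N)%:F * _]mulrC mulrA.
- move=> x y /asboolP [N [Q hQ]] /asboolP [M [Q' hQ']].
  apply/asboolP; exists (N + M)%N, (Q * Q').
  rewrite rmorphM /= -hQ -hQ' exprD rmorphM /=.
  by rewrite mulrACA.
Qed.

End Setting.

HB.instance Definition _ (R : realType) m p :=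
  GRing.isSubringClosed.Build (Fz R m) (@Apred R m p) (@Apred_subring R m p).

Definition Aring (R : realType) m p := {x : Fz R m | x \in @Apred R m p}.
HB.instance Definition _ (R : realType) m p := SubChoice.on (Aring R m p).
HB.instance Definition _ (R : realType) m p := [SubChoice_isSubComNzRing of Aring R m p by <:].

Section Quotient.
Variables (R : realType) (m p : nat).
Local Notation A := (Aring R m p).
Local Notation "x %:F" := (@FracField.tofrac {mpoly R[i][m]} x).

Lemma polyA_mem (Q : {mpoly R[i][m]}) : Q%:F \in @Apred R m p.
Proof. by apply/asboolP; exists 0%N, Q; rewrite expr0 rmorph1 mulr1. Qed.

Definition polyA (Q : {mpoly R[i][m]}) : A := Sub Q%:F (polyA_mem Q).
Definition zA (k : 'I_m) : A := polyA 'X_k.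

Local Notation PA := {mpoly A[m]}.

Definition Ltilde (k : 'I_m) : PA :=
  ((zA k)%:MP * 'X_k) ^+ p
  - ((zA k)%:MP) ^+ p * (\sum_(j < m) (zA j)%:MP * 'X_j) ^+ p.

Definition Itilde (x : PA) : Prop :=
  exists c : 'I_m -> PA, x = \sum_(k < m) c k * Ltilde k.

End Quotient.

(* Main.v *)
Require Import Defs.
From HB Require Import structures.
From mathcomp Require Import all_boot all_order all_fingroup all_algebra.
From mathcomp Require Import fraction complex boolp reals mpoly.
From mathcomp Require Import ring lra.
From mathcomp Require trigo.
Set Implicit Arguments. Unset Strict Implicit. Unset Printing Implicit Defensive.
Import Order.TTheory GRing.Theory Num.Theory.
Local Open Scope ring_scope.

(* Since the z_k are units of A, the ideal is generated by the X_k^p - s^p,   *)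
(* where s = sum_j z_j X_j.  Let E be the algebra of functions on the p^m     *)
(* points (zeta^{i_1}, ..., zeta^{i_m}), F_d the span in E of the monomials   *)
(* of degree <= d, and g = 1 - s as an element of E; inverting R(z) makes g   *)
(* a unit.  Evaluation identifies the degree d part of the quotient with      *)
(* F_d / g F_{d-1}, which vanishes for d > m(p-1).  So the quotient is the    *)
(* cokernel of the map g : (+)_d F_{d-1} -> (+)_d F_d with d <= m(p-1), which *)
(* is split injective, a left inverse being g^-1 followed by the projection   *)
(* of E onto F_{d-1}; its rank telescopes to dim E = p^m.  The cokernel of a  *)
(* split injective matrix Q is free where a maximal minor of Q is inverted,   *)
(* and these minors generate the unit ideal by expanding det (Q L) = 1.       *)

(** * Cokernels of split injective matrices *)

(** The lemmas behind this argument are as follows. [scaled_fermat_idealE] passes to the homogeneous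
    generators X_k^p - s^p. Modulo these, degree d is spanned by the s^(d-|a|) X^a with all a_k < p
    and |a| <= d ([cong_monomial]). At the p^m points X_k^p is 1, so an element of the ideal
    evaluates to a combination of multiples of 1 - s^p, hence of g ([fermat_ideal_coef]); conversely
    elements of g F_{d-1} lift into the ideal ([lift_poly_gM]). So the relations in degree d are
    exactly g F_{d-1} ([gen_poly_relations]).

    The values of g are the linear factors of R(z), which are units of A ([Rfactor_inv]). This kills
    the degrees above m(p-1) ([gen_poly_top]) and splits the presentation ([rel_coef_inv]).
    [card_generators] counts the rank, and [split_presentation_locally_free] concludes. *)

(** Multilinearity in the columns of Q L. This is Cauchy-Binet before grouping: [f] runs over all
    maps, which suffices to place 1 in the ideal of minors. *)
Lemma det_mulmx_minors (A : comNzRingType) k n (Q : 'M[A]_(k, n)) (L : 'M_(n, k)) :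
  \det (Q *m L) =
  \sum_(f : {ffun 'I_k -> 'I_n}) (\prod_i L (f i) i) * \det (colsub f Q).
Proof.
rewrite -det_tr {1}/determinant.
under eq_bigr => s _.
  under eq_bigr => i _ do rewrite !mxE.
  rewrite bigA_distr_bigA mulr_sumr.
  over.
rewrite exchange_big; apply: eq_bigr => f _ /=.
rewrite -(det_tr (colsub f Q)) /determinant mulr_sumr.
apply: eq_bigr => s _; rewrite [RHS]mulrCA; congr (_ * _).
rewrite mulrC -big_split; apply: eq_bigr => i _ /=.
by rewrite !mxE.
Qed.

Section Presentation.
Variables (A : comNzRingType) (V : lmodType A) (S : V -> Prop).
Hypothesis S0 : S 0.
Hypothesis SD : forall x y, S x -> S y -> S (x + y).
Hypothesis SZ : forall a x, S x -> S (a *: x).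
Variables (k n r : nat) (v : 'I_n -> V) (Q : 'M[A]_(k, n)) (L : 'M[A]_(n, k)).
Hypothesis n_eq : n = (k + r)%N.
Hypothesis gen : forall x, exists c : 'rV[A]_n, S (x - \sum_j c 0 j *: v j).
Hypothesis rel : forall c : 'rV[A]_n,
  S (\sum_j c 0 j *: v j) <-> exists y : 'rV_k, c = y *m Q.

(** Cramer's rule: once the minor on the columns [f] is inverted, the relations express the
    generators indexed by the image of [f] through the others, which form a basis. *)
Lemma free_where_minor_invertible (f : 'I_k -> 'I_n) : injective f ->
  exists e : 'I_r -> V,
   (forall x : V, exists (N : nat) (c : 'I_r -> A),
       S (\det (colsub f Q) ^+ N *: x - \sum_(j < r) c j *: e j)) /\
   (forall c : 'I_r -> A, S (\sum_(j < r) c j *: e j) ->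
       exists N : nat, forall j : 'I_r, \det (colsub f Q) ^+ N * c j = 0).
Proof.
move=> f_inj; set d := \det _.
pose B := [set l | l \notin codom f].
have rB : r = #|B|.
  have : #|[set l | l \in codom f]| = k by rewrite cardsE card_codom // card_ord.
  have -> : [set l | l \in codom f] = ~: B by apply/setP=> l; rewrite !inE negbK.
  move=> cardBC; apply/eqP; rewrite -(eqn_add2r k).
  by rewrite -[X in (#|B| + X)%N]cardBC cardsC card_ord addnC -n_eq.
move: n_eq => _; rewrite {}rB.
exists (fun j => v (enum_val j)); split => [x|c Sc].
  have [c Sc] := gen x.
  (* This combination of relations clears the coordinates of [d *: c] on the image of [f]. *)
  pose y := colsub f c *m \adj (colsub f Q).
  pose w := d *: c - y *m Q.
  have w0 i : w 0 (f i) = 0.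
    have : colsub f w = 0.
      have -> : colsub f w = d *: colsub f c - colsub f (y *m Q).
        by apply/matrixP=> a b; rewrite !mxE.
      by rewrite -mulmx_colsub /y -mulmxA mul_adj_mx mul_mx_scalar subrr.
    by move/matrixP/(_ 0 i); rewrite !mxE.
  exists 1%N, (fun j => w 0 (enum_val j)).
  rewrite -(big_enum_val (fun l => w 0 l *: v l)) /=.
  have -> : \sum_(l in B) w 0 l *: v l = \sum_l w 0 l *: v l.
    rewrite [RHS](bigID (mem B)) /= [X in _ = _ + X]big1 ?addr0 // => l.
    by rewrite inE negbK => /codomP[i ->]; rewrite w0 scale0r.
  have -> : d ^+ 1 *: x - \sum_l w 0 l *: v l =
      d *: (x - \sum_j c 0 j *: v j) + \sum_j (y *m Q) 0 j *: v j.
    rewrite expr1 scalerBr -addrA; congr (_ + _).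
    rewrite scaler_sumr -!sumrN -big_split /=; apply: eq_bigr => l _.
    have -> : w 0 l = d * c 0 l - (y *m Q) 0 l.
      by rewrite /w [LHS]mxE [X in X + _]mxE [X in _ + X]mxE.
    by rewrite scalerBl opprB addrC scalerA.
  by apply: SD; [apply: SZ | apply/rel; exists y].
(* Extend [c] by zero on the image of [f]; if this is y Q, then y annihilates the chosen columns, so
   d y = 0. *)
pose c' : 'rV[A]_n := \row_l \sum_(j < #|B|) c j * (enum_val j == l)%:R.
have c'E : \sum_l c' 0 l *: v l = \sum_(j < #|B|) c j *: v (enum_val j).
  under eq_bigr => l _ do rewrite mxE scaler_suml.
  rewrite exchange_big; apply: eq_bigr => j _ /=.
  rewrite (bigD1 (enum_val j)) //= eqxx mulr1 big1 ?addr0 // => l.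
  by rewrite eq_sym => /negPf->; rewrite mulr0 scale0r.
have [y yE] : exists y : 'rV_k, c' = y *m Q by apply/rel; rewrite c'E.
have c'f : y *m colsub f Q = 0.
  apply/matrixP=> a i; rewrite [a]ord1 [RHS]mxE; transitivity (c' 0 (f i)).
    by rewrite yE !mxE; apply: eq_bigr => l _; rewrite mxE.
  rewrite mxE big1 // => j _; case: eqP => [Ej|_]; last by rewrite mulr0.
  by have := enum_valP j; rewrite Ej inE codom_f.
have dy : d *: y = 0.
  by rewrite -mul_mx_scalar -mul_mx_adj mulmxA c'f mul0mx.
exists 1%N => j.
have <- : c' 0 (enum_val j) = c j.
  rewrite mxE (bigD1 j) //= eqxx mulr1 big1 ?addr0 // => i.
  by rewrite (inj_eq enum_val_inj) => /negPf->; rewrite mulr0.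
transitivity ((d *: c') 0 (enum_val j)); first by rewrite [RHS]mxE.
by rewrite yE scalemxAl dy mul0mx mxE.
Qed.

Lemma split_presentation_locally_free : Q *m L = 1%:M -> locally_free_quot S r.
Proof.
move=> QL; pose F := {ffun 'I_k -> 'I_n}.
exists #|{: F}|, (fun i => \det (colsub (enum_val i : F) Q)),
  (fun i => \prod_l L ((enum_val i : F) l) l); split=> [|i].
  rewrite -(big_enum_val (fun f : F => (\prod_l L (f l) l) * \det (colsub f Q))).
  by rewrite /= -det_mulmx_minors QL det1.
move: (enum_val i : F) => f.
have [/injectiveP/free_where_minor_invertible //|/injectivePn[a [b ab fab]]] :=
  boolP (injectiveb f).
(* A repeated column: the localization at 0 is the zero module, and any family is a basis in the
   required sense. *)
have -> : \det (colsub f Q) = 0.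
  by rewrite -det_tr; apply: (determinant_alternate ab) => l; rewrite !mxE fab.
exists (fun=> 0); split=> [x|c _]; last by exists 1%N => j; rewrite mul0r.
exists 1%N, (fun=> 0); rewrite scale0r big1 ?subrr // => j _.
by rewrite scaler0.
Qed.

End Presentation.

(** * The quotient over an arbitrary coefficient ring *)

Section DiscreteFourier.
Variables (A : comNzRingType) (m p : nat) (w pinv : A).
Hypothesis p_gt0 : (0 < p)%N.
Hypothesis wp : w ^+ p = 1.
Hypothesis w_geom : forall j, (0 < j < p)%N -> \sum_(i < p) w ^+ (j * i) = 0.
Hypothesis pinvK : pinv * p%:R = 1.

Local Notation T := {ffun 'I_m -> 'I_p}.

(** [T] indexes both the points, with exponents shifted to 1..p, and the reduced monomials, with
    exponents 0..p-1. *)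
Definition root_pt (t : T) (k : 'I_m) : A := w ^+ (t k).+1.
Definition character_val (b : 'X_{1..m}) (t : T) : A := \prod_k root_pt t k ^+ b k.
Local Notation u := character_val.
Definition exponent (a : T) : 'X_{1..m} := [multinom (a k : nat) | k < m].
Local Notation deg a := (mdeg (exponent a)).
Definition reduce (b : 'X_{1..m}) : T :=
  [ffun k => Ordinal (ltn_pmod (b k) p_gt0)].

(* [w ^+ p.-1] is the inverse of [w]. *)
Definition fourier (a : T) (h : T -> A) : A :=
  pinv ^+ m * \sum_t h t * \prod_k root_pt t k ^+ (p.-1 * a k).

(** [w_geom] replaces primitivity of [w]: over a ring with zero divisors, w^j != 1 would not make
    the geometric sum vanish. *)
Lemma sum_root j : \sum_(i < p) w ^+ (j * i) = (p %| j)%:R * p%:R.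
Proof.
under eq_bigr => i _ do rewrite exprM -(expr_mod _ wp).
rewrite /dvdn; case: posnP => [->|j_gt0].
  under eq_bigr => i _ do rewrite expr0 expr1n.
  by rewrite sumr_const card_ord mul1r.
under eq_bigr => i _ do rewrite -exprM.
by rewrite w_geom ?mul0r // j_gt0 ltn_pmod.
Qed.

Lemma dvdn_add_pred_mul a b : (p %| b + p.-1 * a)%N = (a == b %[mod p]).
Proof.
rewrite /dvdn -[X in _ == X](mod0n p) -(eqn_modDr a) add0n -addnA -mulSnr prednK //.
by rewrite addnC mulnC modnMDl eq_sym.
Qed.

Lemma pinv_prod (b : 'I_m -> bool) :
  pinv ^+ m * \prod_k ((b k)%:R * p%:R) = [forall k, b k]%:R.
Proof.
rewrite -[X in pinv ^+ X]card_ord -prodr_const -big_split /=.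
under eq_bigr => k _ do rewrite mulrCA pinvK mulr1.
case: forallP => [b1|nb]; first by apply: big1 => k _; rewrite b1.
have /existsP[k /negPf bk] : [exists k, ~~ b k].
  by rewrite -negb_forall; apply/negP => /forallP.
by rewrite (bigD1 k) //= bk mul0r.
Qed.

Lemma reduce_exponent a : reduce (exponent a) = a.
Proof. by apply/ffunP=> k; apply: val_inj; rewrite ffunE /= mnmE modn_small. Qed.

Lemma eq_fourier a h h' : h =1 h' -> fourier a h = fourier a h'.
Proof. by move=> eq_h; congr (_ * _); apply: eq_bigr => t _; rewrite eq_h. Qed.

Lemma fourierB a h h' :
  fourier a (fun t => h t - h' t) = fourier a h - fourier a h'.
Proof.
rewrite /fourier -mulrBr -sumrB; congr (_ * _).
by apply: eq_bigr => t _; rewrite mulrBl.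
Qed.

Lemma fourierD a h h' :
  fourier a (fun t => h t + h' t) = fourier a h + fourier a h'.
Proof.
rewrite /fourier -mulrDr -big_split; congr (_ * _).
by apply: eq_bigr => t _; rewrite mulrDl.
Qed.

Lemma fourierZ a c h : fourier a (fun t => c * h t) = c * fourier a h.
Proof.
rewrite /fourier mulrCA; congr (_ * _); rewrite mulr_sumr.
by apply: eq_bigr => t _; rewrite mulrA.
Qed.

Lemma fourier_lin a (I : finType) (P : pred I) (c : I -> A) (h : I -> T -> A) :
  fourier a (fun t => \sum_(i | P i) c i * h i t) =
  \sum_(i | P i) c i * fourier a (h i).
Proof.
rewrite /fourier; under eq_bigr => t _ do rewrite mulr_suml.
rewrite exchange_big mulr_sumr; apply: eq_bigr => i _ /=.
rewrite mulrCA; congr (_ * _); rewrite mulr_sumr.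
by apply: eq_bigr => t _; rewrite mulrA.
Qed.

(** The sum over points factors into m sums over p-th roots of unity, one per coordinate. *)
Lemma fourier_monomial a b : fourier a (fun t => u b t) = (a == reduce b)%:R.
Proof.
have -> : (a == reduce b) = [forall k, (p %| b k + p.-1 * a k)%N].
  apply/eqP/forallP => [-> k|ab].
    by rewrite dvdn_add_pred_mul ffunE /= modn_mod.
  apply/ffunP=> k; apply: val_inj; rewrite ffunE /=.
  by have := ab k; rewrite dvdn_add_pred_mul (modn_small (ltn_ord _)) => /eqP.
rewrite -pinv_prod; congr (_ * _).
have uE t : u b t * \prod_k root_pt t k ^+ (p.-1 * a k) =
    \prod_k (root_pt t k ^+ b k * root_pt t k ^+ (p.-1 * a k)).
  by rewrite big_split.
rewrite (eq_bigr _ (fun t _ => uE t)).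
rewrite -(bigA_distr_bigA (fun k (i : 'I_p) =>
  (w ^+ i.+1) ^+ b k * (w ^+ i.+1) ^+ (p.-1 * a k))) /=.
apply: eq_bigr => k _; rewrite -sum_root.
(* The shift [i.+1] contributes a factor w^j, equal to 1 in the only case, p | j, where the sum is
   not already zero. *)
set j := (b k + _)%N; transitivity (w ^+ j * \sum_(i < p) w ^+ (j * i)).
  rewrite mulr_sumr; apply: eq_bigr => i _.
  by rewrite -exprD -/j -exprM -exprD mulnC -mulnS.
rewrite sum_root -(expr_mod _ wp) /dvdn; case: posnP => [->|_].
  by rewrite expr0 mul1r.
by rewrite mul0r mulr0.
Qed.

(** The dual orthogonality, summing over exponents; it yields the inversion formula. *)
Lemma character_orthogonality t t' :
  pinv ^+ m * \sum_(a : T) ((\prod_k root_pt t' k ^+ (p.-1 * a k)) * u (exponent a) t)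
  = (t' == t)%:R.
Proof.
have -> : (t' == t) = [forall k, (p %| (t k).+1 + p.-1 * (t' k).+1)%N].
  apply/eqP/forallP => [-> k|t't]; first by rewrite dvdn_add_pred_mul.
  apply/ffunP => k; apply: val_inj.
  have := t't k; rewrite dvdn_add_pred_mul -(addn1 (t k)) -(addn1 (t' k)) eqn_modDr.
  by rewrite !modn_small // => /eqP.
rewrite -pinv_prod; congr (_ * _).
have uE (a : T) : (\prod_k root_pt t' k ^+ (p.-1 * a k)) * u (exponent a) t =
    \prod_k (root_pt t' k ^+ (p.-1 * a k) * root_pt t k ^+ a k).
  by rewrite big_split; congr (_ * _); apply: eq_bigr => k _; rewrite mnmE.
rewrite (eq_bigr _ (fun a _ => uE a)).
rewrite -(bigA_distr_bigA (fun k (i : 'I_p) =>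
    root_pt t' k ^+ (p.-1 * i) * root_pt t k ^+ i)) /=.
apply: eq_bigr => k _; rewrite -sum_root; apply: eq_bigr => i _.
rewrite /root_pt -!exprM -exprD; congr (_ ^+ _).
by rewrite mulnA mulnDl addnC [(_ * p.-1)%N]mulnC.
Qed.

Lemma fourier_inversion (h : T -> A) t :
  h t = \sum_a fourier a h * u (exponent a) t.
Proof.
transitivity (\sum_t' h t' * (t' == t)%:R).
  rewrite (bigD1 t) //= eqxx mulr1 big1 ?addr0 // => t' /negPf->.
  by rewrite mulr0.
under eq_bigr => t' _ do rewrite -character_orthogonality mulrCA mulr_sumr mulr_sumr.
rewrite exchange_big; apply: eq_bigr => a _ /=.
rewrite /fourier -mulrA mulr_suml mulr_sumr.
by apply: eq_bigr => t' _; rewrite -[h t' * _ * _]mulrA.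
Qed.

(* The subspace F_{d-1} of E. *)
Definition degree_lt d (h : T -> A) := forall a : T, (d <= deg a)%N -> fourier a h = 0.

Lemma degree_lt_inversion d h t : degree_lt d h ->
  h t = \sum_(a : T | (deg a < d)%N) fourier a h * u (exponent a) t.
Proof.
move=> hd; rewrite [LHS]fourier_inversion [LHS](bigID (fun a : T => (deg a < d)%N)) /=.
rewrite [X in _ + X]big1 ?addr0 // => a; rewrite -leqNgt => /hd->.
by rewrite mul0r.
Qed.

Lemma degree_lt_eq d h h' : h =1 h' -> degree_lt d h -> degree_lt d h'.
Proof. by move=> eq_h hd a /hd <-; apply: eq_fourier => t; rewrite eq_h. Qed.

Lemma degree_ltW d d' h : (d <= d')%N -> degree_lt d h -> degree_lt d' h.
Proof. by move=> le_d hd a le_a; apply: hd; apply: leq_trans le_a. Qed.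

Lemma degree_lt0 d : degree_lt d (fun=> 0).
Proof.
by move=> a _; rewrite /fourier big1 ?mulr0 // => t _; rewrite mul0r.
Qed.

Lemma degree_ltZ d c h : degree_lt d h -> degree_lt d (fun t => c * h t).
Proof. by move=> hd a /hd h0; rewrite fourierZ h0 mulr0. Qed.

Lemma degree_lt_lin d (I : finType) (P : pred I) (c : I -> A) (h : I -> T -> A) :
  (forall i, P i -> degree_lt d (h i)) ->
  degree_lt d (fun t => \sum_(i | P i) c i * h i t).
Proof.
move=> hd a le_a; rewrite fourier_lin big1 // => i Pi.
by rewrite hd // mulr0.
Qed.

Lemma degree_ltD d h h' : degree_lt d h -> degree_lt d h' ->
  degree_lt d (fun t => h t + h' t).
Proof.
by move=> hd h'd a le_a; rewrite fourierD hd // h'd // addr0.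
Qed.

Lemma mdeg_reduce b : (deg (reduce b) <= mdeg b)%N.
Proof.
rewrite !mdegE; apply: leq_sum => k _.
by rewrite mnmE ffunE /= leq_mod.
Qed.

Lemma degree_lt_monomial b : degree_lt (mdeg b).+1 (fun t => u b t).
Proof.
move=> a; rewrite ltnNge fourier_monomial => /negPf ab.
by case: eqP => // aE; rewrite aE mdeg_reduce in ab.
Qed.

(** * Multiplication by g = 1 - s on functions *)

Variables (z : 'I_m -> A) (ginv : T -> A).
Definition linform t := \sum_j z j * root_pt t j.
Hypothesis ginvK : forall t, (1 - linform t) * ginv t = 1.

Lemma character_valU b j t : root_pt t j * u b t = u (b + U_(j))%MM t.
Proof.
rewrite mulrC /character_val; apply/esym.
under eq_bigr => k _ do rewrite mnmDE exprD.
rewrite big_split; congr (_ * _); rewrite (bigD1 j) //= mnm1E eqxx expr1.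
by rewrite big1 ?mulr1 // => k kj; rewrite mnm1E eq_sym (negPf kj) expr0.
Qed.

Lemma linform_character b t : linform t * u b t = \sum_j z j * u (b + U_(j))%MM t.
Proof.
by rewrite mulr_suml; apply: eq_bigr => j _; rewrite -mulrA character_valU.
Qed.

Lemma degree_lt_linform d h :
  degree_lt d h -> degree_lt d.+1 (fun t => linform t * h t).
Proof.
move=> hd; apply: (@degree_lt_eq _ (fun t =>
    \sum_(a : T | (deg a < d)%N) fourier a h * (linform t * u (exponent a) t))).
  move=> t; rewrite (degree_lt_inversion t hd) mulr_sumr.
  by apply: eq_bigr => a _; rewrite mulrCA.
apply: degree_lt_lin => a ad.
apply: (@degree_lt_eq _ (fun t => \sum_j z j * u (exponent a + U_(j))%MM t)).
  by move=> t; rewrite linform_character.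
apply: degree_lt_lin => j _.
apply: (degree_ltW (d := (mdeg (exponent a + U_(j))%MM).+1)); last first.
  exact: degree_lt_monomial.
by rewrite mdegD mdeg1 addn1.
Qed.

Lemma degree_ltMg d h :
  degree_lt d h -> degree_lt d.+1 (fun t => (1 - linform t) * h t).
Proof.
move=> hd; have := degree_ltZ (-1) (degree_lt_linform hd).
move/(degree_ltD (degree_ltW (leqnSn d) hd)); apply: degree_lt_eq => t.
by rewrite mulN1r mulrBl mul1r.
Qed.

(** The subspace g F_{d-1} of E. *)
Definition g_multiple d (h : T -> A) :=
  exists2 f, degree_lt d f & forall t, h t = (1 - linform t) * f t.

Lemma g_multiple_eq d h h' : h =1 h' -> g_multiple d h -> g_multiple d h'.
Proof. by move=> eq_h [f fd hE]; exists f => // t; rewrite -eq_h. Qed.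

Lemma g_multiple0 d h : g_multiple d (fun t => 0 * h t).
Proof.
by exists (fun=> 0) => [|t]; [apply: degree_lt0 | rewrite mul0r mulr0].
Qed.

Lemma g_multipleD d h h' : g_multiple d h -> g_multiple d h' ->
  g_multiple d (fun t => h t + h' t).
Proof.
move=> [f fd hE] [f' f'd hE']; exists (fun t => f t + f' t).
  exact: degree_ltD.
by move=> t; rewrite hE hE' mulrDr.
Qed.

Lemma g_multiple_lin d (I : finType) (P : pred I) (c : I -> A) (h : I -> T -> A) :
  (forall i, P i -> g_multiple d (h i)) ->
  g_multiple d (fun t => \sum_(i | P i) c i * h i t).
Proof.
move=> hd; have [f fP] : exists f : I -> T -> A, forall i, P i ->
    degree_lt d (f i) /\ forall t, h i t = (1 - linform t) * f i t.
  apply: (fin_all_exists (P := fun i f => P i ->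
    degree_lt d f /\ forall t, h i t = (1 - linform t) * f t)) => i.
  case Pi: (P i); last by exists (fun=> 0).
  by have [f fd hE] := hd i Pi; exists f.
exists (fun t => \sum_(i | P i) c i * f i t).
  by apply: degree_lt_lin => i /fP[].
move=> t; rewrite mulr_sumr; apply: eq_bigr => i /fP[_ ->].
by rewrite mulrCA.
Qed.

(** Factor 1 - s^e as g (1 + s + ... + s^(e-1)); for h in F_d the cofactor times h lies in
    F_{d+e-1}. The induction also carries s^e h in F_{d+e}, which supplies the next summand. *)
Lemma g_multiple_geom d e h : degree_lt d.+1 h ->
  g_multiple (d + e) (fun t => (1 - linform t ^+ e) * h t).
Proof.
move=> hd; suff [f [fd hf Uf]] : exists f, [/\ degree_lt (d + e) f,
    forall t, (1 - linform t ^+ e) * h t = (1 - linform t) * f t &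
    degree_lt (d + e).+1 (fun t => linform t ^+ e * h t)] by exists f.
elim: e => [|e [f [fd hf Uf]]].
  rewrite addn0; exists (fun=> 0); split; first exact: degree_lt0.
  - by move=> t; rewrite expr0 subrr mul0r mulr0.
  - by apply: degree_lt_eq hd => t; rewrite expr0 mul1r.
rewrite addnS; exists (fun t => f t + linform t ^+ e * h t); split.
- by apply: degree_ltD => //; apply: (degree_ltW _ fd).
- by move=> t; rewrite mulrDr -hf exprS; ring.
- apply: degree_lt_eq (degree_lt_linform Uf) => t.
  by rewrite exprS mulrA.
Qed.

(** * Polynomials modulo the ideal *)

Local Notation PA := {mpoly A[m]}.
Definition lin_poly : PA := \sum_j z j *: 'X_j.
Local Notation s := lin_poly.
Definition fermat_ideal (x : PA) : Prop :=
  exists c : 'I_m -> PA, x = \sum_k c k * ('X_k ^+ p - s ^+ p).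
Local Notation S := fermat_ideal.

Lemma fermat_ideal0 : S 0.
Proof. by exists (fun=> 0); rewrite big1 // => k _; rewrite mul0r. Qed.

Lemma fermat_idealD x y : S x -> S y -> S (x + y).
Proof.
move=> [c ->] [c' ->]; exists (fun k => c k + c' k).
by rewrite -big_split; apply: eq_bigr => k _; rewrite mulrDl.
Qed.

Lemma fermat_idealM y x : S x -> S (y * x).
Proof.
move=> [c ->]; exists (fun k => y * c k).
by rewrite mulr_sumr; apply: eq_bigr => k _; rewrite mulrA.
Qed.

Lemma fermat_idealZ a x : S x -> S (a *: x).
Proof. by rewrite -mul_mpolyC; apply: fermat_idealM. Qed.

Lemma fermat_idealN x : S x -> S (- x).
Proof. by rewrite -mulN1r; apply: fermat_idealM. Qed.

Lemma fermat_ideal_sum (I : Type) (r : seq I) (P : pred I) (F : I -> PA) :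
  (forall i, P i -> S (F i)) -> S (\sum_(i <- r | P i) F i).
Proof.
by move=> SF; apply: big_ind => //; [apply: fermat_ideal0 | apply: fermat_idealD].
Qed.

Lemma congM x x' y y' : S (x - x') -> S (y - y') -> S (x * y - x' * y').
Proof.
move=> Sx Sy.
have -> : x * y - x' * y' = y * (x - x') + x' * (y - y') by ring.
by apply: fermat_idealD; apply: fermat_idealM.
Qed.

Lemma congX x x' n : S (x - x') -> S (x ^+ n - x' ^+ n).
Proof.
move=> Sx; elim: n => [|n IH]; first by rewrite subrr; apply: fermat_ideal0.
by rewrite !exprS; apply: congM.
Qed.

Lemma cong_prod (x y : 'I_m -> PA) :
  (forall k, S (x k - y k)) -> S (\prod_k x k - \prod_k y k).
Proof.
move=> Sxy; apply: (big_ind2 (fun x y => S (x - y))) => //.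
  by rewrite subrr; apply: fermat_ideal0.
by move=> *; apply: congM.
Qed.

Lemma cong_fermat k : S ('X_k ^+ p - s ^+ p).
Proof.
exists (fun j => (j == k)%:R); rewrite (bigD1 k) //= eqxx mul1r.
by rewrite big1 ?addr0 // => j /negPf->; rewrite mul0r.
Qed.

(** The power of s pads X^a to degree d; for |a| <= d its values differ from those of X^a by an
    element of g F_{d-1}. *)
Definition gen_poly d (a : T) : PA := s ^+ (d - deg a) * 'X_[exponent a].

(** Divide each b_k by p and trade every X_k^p for s^p; the total degree is preserved. *)
Lemma cong_monomial d b : (mdeg b <= d)%N ->
  S (s ^+ (d - mdeg b) * 'X_[b] - gen_poly d (reduce b)).
Proof.
move=> bd; have degE : mdeg b = (\sum_k p * (b k %/ p) + deg (reduce b))%N.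
  rewrite !mdegE -big_split /=; apply: eq_bigr => k _.
  by rewrite mnmE ffunE /= mulnC -divn_eq.
have -> : gen_poly d (reduce b) = s ^+ (d - mdeg b) *
    \prod_k (s ^+ (p * (b k %/ p)) * 'X_k ^+ (b k %% p)).
  rewrite big_split /= prodrXr mulrA -exprD /gen_poly; congr (_ ^+ _ * _).
    by rewrite [RHS]addnC addnBA // degE subnDl.
  by rewrite mpolyXE_id; apply: eq_bigr => k _; rewrite mnmE ffunE.
rewrite -mulrBr; apply: fermat_idealM.
rewrite mpolyXE_id; apply: cong_prod => k.
rewrite {1}(divn_eq (b k) p) exprD [(_ * p)%N]mulnC !exprM.
apply: congM; last by rewrite subrr; apply: fermat_ideal0.
by apply: congX; apply: cong_fermat.
Qed.

(* Inverse to evaluation in degree d, modulo the ideal and g F_{d-1}; meaningful *)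
(* for h in F_d, the exponent [d - deg a] in [gen_poly] being truncated          *)
(* otherwise.                                                                    *)
Definition lift_poly d h : PA := \sum_a fourier a h *: gen_poly d a.

Lemma lift_poly_monomial d b : lift_poly d (u b) = gen_poly d (reduce b).
Proof.
rewrite /lift_poly (bigD1 (reduce b)) //= fourier_monomial eqxx scale1r.
by rewrite big1 ?addr0 // => a /negPf ab; rewrite fourier_monomial ab scale0r.
Qed.

(* Modulo the ideal, the lift of g u^a is (s - sum_j z_j X_j) s^(d-1-|a|) X^a = 0. *)
Lemma lift_poly_rel d a : (deg a < d)%N ->
  S (lift_poly d (fun t => (1 - linform t) * u (exponent a) t)).
Proof.
move=> ad; set b := exponent a.
have -> : lift_poly d (fun t => (1 - linform t) * u b t) =
    gen_poly d (reduce b) - \sum_j z j *: gen_poly d (reduce (b + U_(j))%MM).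
  rewrite -lift_poly_monomial.
  under eq_bigr => j _ do rewrite -lift_poly_monomial /lift_poly scaler_sumr.
  rewrite exchange_big -sumrB; apply: eq_bigr => c _ /=.
  under eq_bigr => j _ do rewrite scalerA.
  rewrite -scaler_suml -scalerBl; congr (_ *: _).
  rewrite -fourier_lin -fourierB; apply: eq_fourier => t.
  by rewrite mulrBl mul1r linform_character.
pose y := s ^+ (d - (mdeg b).+1) * 'X_[b].
have s0 : s ^+ (d - mdeg b) * 'X_[b] = \sum_j z j *: ('X_j * y).
  under eq_bigr => j _ do rewrite scalerAl.
  by rewrite -mulr_suml -/s mulrA -exprS subnSK.
have -> : gen_poly d (reduce b) - \sum_j z j *: gen_poly d (reduce (b + U_(j))%MM) =
    - (s ^+ (d - mdeg b) * 'X_[b] - gen_poly d (reduce b)) +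
    (\sum_j z j *: ('X_j * y) - \sum_j z j *: gen_poly d (reduce (b + U_(j))%MM)).
  by rewrite s0 opprB addrA subrK.
apply: fermat_idealD; first by apply/fermat_idealN/cong_monomial/ltnW.
rewrite -sumrB; apply: fermat_ideal_sum => j _.
rewrite -scalerBr; apply: fermat_idealZ.
have -> : 'X_j * y = s ^+ (d - mdeg (b + U_(j))%MM) * 'X_[b + U_(j)].
  by rewrite mdegD mdeg1 addn1 mpolyXD mulrC -mulrA.
by apply: cong_monomial; rewrite mdegD mdeg1 addn1.
Qed.

Lemma lift_poly_gM d h : degree_lt d h ->
  S (lift_poly d (fun t => (1 - linform t) * h t)).
Proof.
move=> hd; have -> : lift_poly d (fun t => (1 - linform t) * h t) =
    \sum_(a : T | (deg a < d)%N) fourier a h *: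
      lift_poly d (fun t => (1 - linform t) * u (exponent a) t).
  under [RHS]eq_bigr => a _ do rewrite /lift_poly scaler_sumr.
  rewrite exchange_big; apply: eq_bigr => c _ /=.
  under [RHS]eq_bigr => a _ do rewrite scalerA.
  rewrite -scaler_suml; congr (_ *: _).
  rewrite -fourier_lin; apply: eq_fourier => t.
  rewrite (degree_lt_inversion t hd) mulr_sumr.
  by apply: eq_bigr => a _; rewrite mulrCA.
by apply: fermat_ideal_sum => a ad; apply/fermat_idealZ/lift_poly_rel.
Qed.

(** * Generators in degrees up to m(p-1) *)

Definition top_degree := (m * p.-1)%N.

Lemma deg_le_top (a : T) : (deg a <= top_degree)%N.
Proof.
rewrite mdegE /top_degree -[X in (X * _)%N]card_ord -sum_nat_const.
by apply: leq_sum => k _; rewrite mnmE -ltnS prednK.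
Qed.

(** Above the top degree F_{d-1} is all of E, so u^a = g (g^-1 u^a) lies in g F_{d-1} and its lift
    is in the ideal. *)
Lemma gen_poly_top d a : (top_degree < d)%N -> S (gen_poly d a).
Proof.
move=> td; rewrite -(reduce_exponent a) -lift_poly_monomial.
have -> : lift_poly d (u (exponent a)) =
    lift_poly d (fun t => (1 - linform t) * (ginv t * u (exponent a) t)).
  apply: eq_bigr => c _; congr (_ *: _); apply: eq_fourier => t.
  by rewrite mulrA ginvK mul1r.
apply: lift_poly_gM => c dc.
by have := leq_trans td (leq_trans dc (deg_le_top c)); rewrite ltnn.
Qed.

Local Notation I := ('I_top_degree.+1 * T)%type.
(** [J] indexes the generators, a basis of the sum of the F_d; [K] indexes the relations, a basis of
    the sum of the F_{d-1}. *)
Local Notation J := [set i : I | (deg i.2 <= i.1)%N].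
Local Notation K := [set i : I | (deg i.2 < i.1)%N].

Lemma sum_fixed_degree (W : nmodType) (P : pred I) (d : 'I_top_degree.+1) (F : I -> W) :
  \sum_(i | P i && (i.1 == d)) F i = \sum_(a | P (d, a)) F (d, a).
Proof.
rewrite (reindex_onto (fun a => (d, a)) snd) => [|[d' a] /= /andP[_ /eqP->] //].
by apply: eq_bigl => a; rewrite !eqxx !andbT.
Qed.

Lemma gen_poly_span x : exists c : I -> A,
  S (x - \sum_(i in J) c i *: gen_poly i.1 i.2).
Proof.
rewrite [x]mpolyE; apply: (big_ind (fun x => exists c : I -> A,
  S (x - \sum_(i in J) c i *: gen_poly i.1 i.2))) => [|y y' [c Sc] [c' Sc']|b _].
- exists (fun=> 0); rewrite big1 ?subr0; first exact: fermat_ideal0.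
  by move=> i _; rewrite scale0r.
- exists (fun i => c i + c' i).
  under eq_bigr => i _ do rewrite scalerDl.
  by rewrite big_split opprD addrACA; apply: fermat_idealD.
have Sb : S ('X_[b] - gen_poly (mdeg b) (reduce b)).
  by have := cong_monomial (leqnn (mdeg b)); rewrite subnn expr0 mul1r.
have [td|bt] := ltnP top_degree (mdeg b).
  exists (fun=> 0); rewrite big1 ?subr0 => [|i _]; last by rewrite scale0r.
  apply: fermat_idealZ; rewrite -(subrK (gen_poly (mdeg b) (reduce b)) 'X_[b]).
  by apply: fermat_idealD => //; apply: gen_poly_top.
exists (fun i => x@_b * (i == (inord (mdeg b), reduce b))%:R).
rewrite (bigD1 (inord (mdeg b), reduce b)) /=; last first.
  by rewrite inE /= inordK // mdeg_reduce.
rewrite eqxx mulr1 big1 ?addr0 => [|i /andP[_ /negPf->]]; last first.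
  by rewrite mulr0 scale0r.
by rewrite -scalerBr inordK //; apply: fermat_idealZ.
Qed.

(* The indeterminate of {poly A} records the degree: the coefficient of 'X^d is *)
(* the value at [root_pt t] of the degree d part of [q].                       *)
Definition eval_poly t (q : PA) : {poly A} :=
  mmap (@polyC A) (fun k => (root_pt t k)%:P * 'X) q.

Lemma eval_poly_monomial t b : eval_poly t 'X_[b] = (u b t)%:P * 'X^(mdeg b).
Proof.
rewrite /eval_poly mmapX /mmap1 mdegE -prodrXr rmorph_prod -big_split /=.
by apply: eq_bigr => k _; rewrite exprMn -polyC_exp.
Qed.

Lemma eval_poly_linform t : eval_poly t s = (linform t)%:P * 'X.
Proof.
rewrite /eval_poly raddf_sum rmorph_sum mulr_suml; apply: eq_bigr => j _ /=.
by rewrite mmapZ mmapX mmap1U polyCM mulrA.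
Qed.

Lemma degree_lt_coef q d : degree_lt d.+1 (fun t => (eval_poly t q)`_d).
Proof.
rewrite [q]mpolyE; apply: (big_ind (fun q => degree_lt d.+1
  (fun t => (eval_poly t q)`_d))) => [|x y xd yd|b _].
- by apply: (degree_lt_eq _ (@degree_lt0 d.+1)) => t; rewrite /eval_poly raddf0 coef0.
- by apply: (degree_lt_eq _ (degree_ltD xd yd)) => t; rewrite /eval_poly raddfD coefD.
have [<-|nb] := eqVneq (mdeg b) d.
  apply: (degree_lt_eq _ (degree_ltZ q@_b (@degree_lt_monomial b))) => t.
  rewrite [eval_poly _ _]mmapZ -/(eval_poly _ _) eval_poly_monomial mulrA -polyCM.
  by rewrite coefCM coefXn eqxx mulr1.
apply: (degree_lt_eq _ (@degree_lt0 d.+1)) => t.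
rewrite [eval_poly _ _]mmapZ -/(eval_poly _ _) eval_poly_monomial mulrA -polyCM.
by rewrite coefCM coefXn eq_sym (negPf nb) mulr0.
Qed.

(** X_k^p - s^p evaluates to (1 - s^p) times the p-th power of the degree variable, as w^p = 1. Its
    cofactor contributes in degree d - p, and [g_multiple_geom] brings the product back to g
    F_{d-1}. *)
Lemma fermat_ideal_coef q d : S q -> g_multiple d (fun t => (eval_poly t q)`_d).
Proof.
move=> [c ->].
apply: (@g_multiple_eq _ (fun t => \sum_k
   1 * ((p <= d)%N%:R * ((1 - linform t ^+ p) * (eval_poly t (c k))`_(d - p))))).
  move=> t; rewrite /eval_poly raddf_sum coef_sum; apply: eq_bigr => k _ /=.
  rewrite rmorphM rmorphB !rmorphXn /= -!/(eval_poly _ _) eval_poly_linform.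
  rewrite eval_poly_monomial mdeg1 expr1 !exprMn.
  have -> : u U_(k)%MM t = root_pt t k.
    by rewrite -[LHS]/(mmap1 _ _) mmap1U.
  rewrite -rmorphXn /= -exprM mulnC exprM wp expr1n mul1r.
  transitivity ((eval_poly t (c k) * (1 - linform t ^+ p)%:P * 'X^p)`_d); last first.
    by congr (nth _ (polyseq _) _); rewrite polyCB polyC_exp; ring.
  rewrite coefMXn coefMC.
  by rewrite ltnNge; case: (p <= d)%N; rewrite /= ?mul0r ?mul1r // mulrC.
apply: g_multiple_lin => k _; have [pd|_] := leqP p d; last first.
  exact: g_multiple0.
rewrite -{1}(subnK pd).
apply: g_multiple_eq (g_multiple_geom p (@degree_lt_coef (c k) (d - p))) => t.
by rewrite mul1r.
Qed.

Lemma coef_eval_gen_poly t d e a : (deg a <= e)%N ->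
  (eval_poly t (gen_poly e a))`_d =
  (e == d)%:R * (linform t ^+ (e - deg a) * u (exponent a) t).
Proof.
move=> ae; rewrite /gen_poly [eval_poly _ _]rmorphM rmorphXn /=.
rewrite -!/(eval_poly _ _) eval_poly_linform eval_poly_monomial exprMn -rmorphXn /=.
rewrite mulrACA -rmorphM /= -exprD subnK // coefCM coefXn mulrC.
by rewrite eq_sym.
Qed.

(** * Rank count and the presentation matrix *)

(** What [J] has beyond [K] is the diagonal d = |a|, one index for each [a], because |a| never
    exceeds the top degree. *)
Lemma card_generators : #|J| = (#|K| + p ^ m)%N.
Proof.
have -> : J = K :|: [set i : I | deg i.2 == i.1].
  by apply/setP=> i; rewrite !inE leq_eqVlt orbC.
rewrite cardsU -[RHS]subn0; congr (_ + _ - _)%N.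
  have <- : #|[set: T]| = (p ^ m)%N by rewrite cardsT card_ffun !card_ord.
  rewrite -(@card_imset _ _ (fun a : T => (inord (deg a) : 'I_top_degree.+1, a))).
    apply: eq_card => -[d a]; rewrite inE /=; apply/eqP/imsetP => [ad|[b _ [-> ->]]].
      by exists a; rewrite ?inE // (eqP (_ : deg a == d)) ?inord_val ?ad.
    by rewrite inordK // ltnS deg_le_top.
  by move=> a b [_ ->].
apply/eqP; rewrite cards_eq0; apply/eqP/setP=> i; rewrite !inE ltn_neqAle.
by case: (deg i.2 == i.1); rewrite ?andbF.
Qed.

(** The block-diagonal matrix of g from F_{d-1} to F_d in the monomial bases; [rel_inv_coef] gives
    the entries of g^-1. *)
Definition rel_coef (i j : I) : A :=
  (j.1 == i.1)%:R * fourier j.2 (fun t => (1 - linform t) * u (exponent i.2) t).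
Definition rel_inv_coef (j i : I) : A :=
  fourier i.2 (fun t => ginv t * u (exponent j.2) t).

(** The restriction |a| <= d loses no term, since g u^b lies in F_d when |b| < d. *)
Lemma sum_rel_coef (W : lmodType A) (i : I) (F : I -> W) : i \in K ->
  \sum_(j in J) rel_coef i j *: F j =
  \sum_a fourier a (fun t => (1 - linform t) * u (exponent i.2) t) *: F (i.1, a).
Proof.
rewrite inE => iK.
rewrite (bigID (fun j : I => j.1 == i.1)) /= [X in _ + X]big1 ?addr0; last first.
  by move=> j /andP[_ /negPf ji]; rewrite /rel_coef ji mul0r scale0r.
rewrite (eq_bigl (fun j : I => (deg j.2 <= j.1)%N && (j.1 == i.1))) => [|j]; last first.
  by rewrite inE.
rewrite (sum_fixed_degree (fun j : I => (deg j.2 <= j.1)%N)).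
rewrite [RHS](bigID (fun a : T => (deg a <= i.1)%N)) /=.
rewrite [X in _ + X]big1 ?addr0 => [|a].
  by apply: eq_bigr => a _; rewrite /rel_coef eqxx mul1r.
rewrite -ltnNge => ia.
have /(degree_ltW iK)/degree_ltMg -> // := @degree_lt_monomial (exponent i.2).
by rewrite scale0r.
Qed.

Lemma rel_coef_inv i i' : i \in K -> i' \in K ->
  \sum_(j in J) rel_coef i j * ((j.1 == i'.1)%:R * rel_inv_coef j i') = (i == i')%:R.
Proof.
move=> iK i'K.
rewrite (sum_rel_coef (fun j => (j.1 == i'.1)%:R * rel_inv_coef j i' : A^o)) //=.
under eq_bigr => a _ do rewrite -[_ *: _]/(_ * _) mulrCA.
rewrite -mulr_sumr /rel_inv_coef /= -fourier_lin.
rewrite (@eq_fourier _ _ (u (exponent i.2))) => [|t].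
  rewrite fourier_monomial reduce_exponent -natrM mulnb eq_sym.
  by congr (_ %:R); rewrite -[i == i']/(_ && _) eq_sym [i'.2 == _]eq_sym.
under eq_bigr => a _ do rewrite mulrCA.
rewrite -mulr_sumr -fourier_inversion mulrA [ginv t * _]mulrC ginvK mul1r.
by [].
Qed.

(** In each degree d, the function h_d = sum of c_(d,a) u^a is some g f_d with f_d in F_{d-1}; the
    Fourier coefficients of the f_d are the required [y]. *)
Lemma gen_poly_relations (c : I -> A) :
  S (\sum_(i in J) c i *: gen_poly i.1 i.2) ->
  exists y : I -> A, forall j, j \in J -> c j = \sum_(i in K) y i * rel_coef i j.
Proof.
move=> Sc.
pose h (d : 'I_top_degree.+1) t :=
  \sum_(a : T | (deg a <= d)%N) c (d, a) * u (exponent a) t.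
have [f fP] : exists f : 'I_top_degree.+1 -> T -> A, forall d : 'I_top_degree.+1,
    degree_lt d (f d) /\ forall t, h d t = (1 - linform t) * f d t.
  apply: (fin_all_exists (P := fun (d : 'I_top_degree.+1) (f : T -> A) =>
    degree_lt d f /\ forall t, h d t = (1 - linform t) * f t)) => d.
  suff [f fd hE] : g_multiple d (h d) by exists f.
  (* Evaluation gives the u^a weighted by s^(d-|a|); this correction, also in g F_{d-1}, removes the
     weights. *)
  have geom : g_multiple d (fun t => \sum_(a : T | (deg a <= d)%N) c (d, a) *
      ((1 - linform t ^+ (d - deg a)) * u (exponent a) t)).
    apply: g_multiple_lin => a ad; rewrite -{1}(subnKC ad).
    by apply: g_multiple_geom; apply: degree_lt_monomial.
  apply: g_multiple_eq (g_multipleD (fermat_ideal_coef d Sc) geom) => t.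
  rewrite /eval_poly raddf_sum coef_sum /=.
  rewrite (bigID (fun i : I => i.1 == d)) /= [X in _ + X + _]big1 ?addr0; last first.
    move=> i /andP[iJ /negPf id]; rewrite mmapZ coefCM.
    rewrite coef_eval_gen_poly; last by rewrite inE in iJ.
    by rewrite val_eqE id mul0r mulr0.
  rewrite (eq_bigl (fun j : I => (deg j.2 <= j.1)%N && (j.1 == d))) => [|j]; last first.
    by rewrite inE.
  rewrite (sum_fixed_degree (fun j : I => (deg j.2 <= j.1)%N)) -big_split.
  apply: eq_bigr => a ad /=; rewrite mmapZ coefCM coef_eval_gen_poly //.
  by rewrite eqxx mul1r -mulrDr -mulrDl addrC subrK mul1r.
exists (fun i => fourier i.2 (f i.1)) => -[d b]; rewrite inE /= => bd.
have [fd hE] := fP d.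
transitivity (fourier b (h d)).
  rewrite /h fourier_lin (bigD1 b) //= fourier_monomial reduce_exponent eqxx mulr1.
  rewrite big1 ?addr0 // => a /andP[_ ab].
  by rewrite fourier_monomial reduce_exponent eq_sym (negPf ab) mulr0.
rewrite (bigID (fun i : I => i.1 == d)) /= [X in _ + X]big1 ?addr0; last first.
  by move=> i /andP[_ /negPf id]; rewrite /rel_coef eq_sym id mul0r mulr0.
rewrite (eq_bigl (fun j : I => (deg j.2 < j.1)%N && (j.1 == d))) => [|j]; last first.
  by rewrite inE.
rewrite (sum_fixed_degree (fun j : I => (deg j.2 < j.1)%N)) /=.
under eq_bigr => a _ do rewrite /rel_coef eqxx mul1r.
rewrite -fourier_lin; apply: eq_fourier => t.
rewrite hE (degree_lt_inversion t fd) mulr_sumr.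
by apply: eq_bigr => a _; rewrite mulrCA.
Qed.

Lemma fermat_quotient_locally_free : locally_free_quot S (p ^ m).
Proof.
pose Q : 'M[A]_(#|K|, #|J|) := \matrix_(i, j) rel_coef (enum_val i) (enum_val j).
pose L : 'M[A]_(#|J|, #|K|) := \matrix_(j, i)
  (((enum_val j).1 == (enum_val i).1)%:R * rel_inv_coef (enum_val j) (enum_val i)).
pose v (j : 'I_#|J|) := gen_poly (enum_val j).1 (enum_val j).2.
have vE (c : I -> A) :
    \sum_j c (enum_val j) *: v j = \sum_(i in J) c i *: gen_poly i.1 i.2.
  by rewrite (big_enum_val (fun i : I => c i *: gen_poly i.1 i.2)).
apply: (@split_presentation_locally_free _ _ S fermat_ideal0 fermat_idealD
  fermat_idealZ _ _ _ v Q L card_generators).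
- move=> x; have [c Sc] := gen_poly_span x; exists (\row_j c (enum_val j)).
  by under eq_bigr => j _ do rewrite mxE; rewrite vE.
- move=> c; split=> [Sc|[y ->]].
    (* The row vector as a function on all of [I], zero off [J]. *)
    pose c0 i := \sum_(j | enum_val j == i) c 0 j.
    have c0E j : c0 (enum_val j) = c 0 j.
      rewrite /c0 (eq_bigl (pred1 j)) ?big_pred1_eq // => i.
      by rewrite /= (inj_eq enum_val_inj).
    have [|y yP] := @gen_poly_relations c0.
      by rewrite -vE; under eq_bigr => j _ do rewrite c0E.
    exists (\row_i y (enum_val i)); apply/rowP=> j.
    rewrite -c0E yP ?enum_valP // mxE.
    rewrite (big_enum_val (fun i : I => y i * rel_coef i (enum_val j))).
    by apply: eq_bigr => i _; rewrite !mxE.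
  under eq_bigr => j _ do rewrite mxE scaler_suml.
  rewrite exchange_big; apply: fermat_ideal_sum => i _ /=.
  under eq_bigr => j _ do rewrite mxE -scalerA.
  rewrite -scaler_sumr; apply: fermat_idealZ.
  rewrite (vE (rel_coef (enum_val i))) sum_rel_coef ?enum_valP //.
  by apply: lift_poly_rel; have := enum_valP i; rewrite inE.
- apply/matrixP => i i'; rewrite !mxE; under eq_bigr => j _ do rewrite !mxE.
  rewrite -(big_enum_val (fun j : I => rel_coef (enum_val i) j *
    ((j.1 == (enum_val i').1)%:R * rel_inv_coef j (enum_val i')))) /=.
  by rewrite rel_coef_inv ?enum_valP // (inj_eq enum_val_inj).
Qed.
End DiscreteFourier.

Definition scaled_fermat_ideal (A : comNzRingType) m p (z : 'I_m -> A)
    (x : {mpoly A[m]}) : Prop :=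
  exists c : 'I_m -> {mpoly A[m]}, x = \sum_(k < m) c k *
    (((z k)%:MP * 'X_k) ^+ p
     - ((z k)%:MP) ^+ p * (\sum_(j < m) (z j)%:MP * 'X_j) ^+ p).

(** The two families of generators differ by the units z_k^p. *)
Lemma scaled_fermat_idealE (A : comNzRingType) m p (z zi : 'I_m -> A) :
  (forall k, z k * zi k = 1) -> scaled_fermat_ideal p z = fermat_ideal p z.
Proof.
move=> ziK.
have LE k : ((z k)%:MP * 'X_k) ^+ p
     - ((z k)%:MP) ^+ p * (\sum_(j < m) (z j)%:MP * 'X_j) ^+ p =
    (z k ^+ p)%:MP * ('X_k ^+ p - lin_poly z ^+ p).
  rewrite exprMn rmorphXn /= mulrBr; congr (_ - _ * _ ^+ _).
  by apply: eq_bigr => j _; rewrite mul_mpolyC.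
apply/funext => x; apply/propext; split=> -[c ->].
  exists (fun k => c k * (z k ^+ p)%:MP); apply: eq_bigr => k _.
  by rewrite LE mulrA.
exists (fun k => c k * (zi k ^+ p)%:MP); apply: eq_bigr => k _.
rewrite LE -mulrA; congr (_ * _); rewrite mulrA -mpolyCM -exprMn mulrC.
by rewrite [zi k * _]mulrC ziK expr1n mpolyC1 mulr1.
Qed.

(** * The coefficient ring A *)

Section RootOfUnity.
Variables (R : realType) (p : nat).
Local Notation zeta := (zeta R p).

Lemma zeta_exp n : zeta ^+ n =
  Complex (trigo.cos (2 * trigo.pi / p%:R *+ n)) (trigo.sin (2 * trigo.pi / p%:R *+ n)).
Proof.
elim: n => [|n IH]; first by rewrite expr0 mulr0n trigo.cos0 trigo.sin0.
rewrite /Defs.zeta in IH *; set x := _ / _ in IH *.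
rewrite exprS IH mulrS trigo.cosD trigo.sinD.
by apply/eqP; rewrite eq_complex /=; apply/andP; split; apply/eqP; ring.
Qed.

Lemma zeta_unity : (0 < p)%N -> zeta ^+ p = 1.
Proof.
move=> p_gt0; rewrite zeta_exp -[_ *+ p]mulr_natr divfK ?pnatr_eq0 -?lt0n //.
by rewrite mulr_natl trigo.cos2pi trigo.sin2pi.
Qed.

Lemma zeta_exp_neq1 j : (0 < j < p)%N -> zeta ^+ j != 1.
Proof.
move=> /andP[j_gt0 jp]; have p_gt0 : (0 < p)%N by apply: leq_trans jp.
have pR_gt0 : 0 < p%:R :> R by rewrite ltr0n.
rewrite zeta_exp eq_complex /=; apply/nandP; left.
(* The real part is cos(2x) = 1 - 2 sin(x)^2 with 0 < x < pi, hence less than 1. *)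
set x : R := trigo.pi * j%:R / p%:R.
have -> : 2 * trigo.pi / p%:R *+ j = x *+ 2 :> R by rewrite /x; ring.
have sx : 0 < trigo.sin x.
  apply: trigo.sin_gt0_pi; rewrite divr_gt0 ?mulr_gt0 ?trigo.pi_gt0 ?ltr0n //=.
  by rewrite ltr_pdivrMr // ltr_pM2l ?trigo.pi_gt0 // ltr_nat.
rewrite trigo.cos_mulr2n trigo.cos2sin2 lt_eqF //.
have := exprn_gt0 2 sx; lra.
Qed.

Lemma zeta_geom j : (0 < j < p)%N -> \sum_(i < p) zeta ^+ (j * i) = 0.
Proof.
move=> jp; have p_gt0 : (0 < p)%N by case/andP: jp => _; apply: leq_trans.
have := subrX1 (zeta ^+ j) p; rewrite -exprM mulnC exprM zeta_unity // expr1n subrr.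
move/esym/eqP; rewrite mulf_eq0 subr_eq0 (negPf (zeta_exp_neq1 jp)) /= => /eqP sum0.
by rewrite -[RHS]sum0; apply: eq_bigr => i _; rewrite exprM.
Qed.

End RootOfUnity.

Section CoefficientRing.
Variables (R : realType) (m p : nat).
Local Notation C := (R[i]).
Local Notation A := (Aring R m p).
Local Notation D := (Dpoly R m p).

Lemma polyA_is_zmod_morphism : zmod_morphism (@polyA R m p).
Proof. by move=> x y; apply: val_inj; rewrite /= rmorphB. Qed.

Lemma polyA_is_monoid_morphism : monoid_morphism (@polyA R m p).
Proof. by split=> [|x y]; apply: val_inj; rewrite /= (rmorph1, rmorphM). Qed.

HB.instance Definition _ :=
  GRing.isZmodMorphism.Build _ _ (@polyA R m p) polyA_is_zmod_morphism.
HB.instance Definition _ :=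
  GRing.isMonoidMorphism.Build _ _ (@polyA R m p) polyA_is_monoid_morphism.

Lemma linear_factor_neq0 (c : 'I_m -> C) :
  1 - \sum_(j < m) (c j)%:MP * 'X_j != 0 :> {mpoly C[m]}.
Proof.
(* The value at the origin is 1. *)
apply: contraTneq (oner_neq0 C) => /(congr1 (meval (fun=> 0))).
rewrite rmorphB rmorph1 rmorph0 rmorph_sum big1 ?subr0 => [->|j _]; first by rewrite eqxx.
by rewrite /= mevalM mevalXU mulr0.
Qed.

Lemma Dpoly_neq0 : D != 0.
Proof.
rewrite mulf_neq0 //; apply/prodf_neq0 => i _; first by rewrite -msupp_eq0 msuppX.
exact: linear_factor_neq0.
Qed.

(** A divisor Q of D has inverse Q'/D; both the z_k and the factors of R(z) are such divisors. *)
Lemma polyA_inv (Q Q' : {mpoly C[m]}) : Q * Q' = D ->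
  exists y : A, polyA p Q * y = 1.
Proof.
move=> QQ'; have D0 : FracField.tofrac D != 0 by rewrite tofrac_eq0 Dpoly_neq0.
have yA : FracField.tofrac Q' / FracField.tofrac D \in @Apred R m p.
  by apply/asboolP; exists 1%N, Q'; rewrite expr1 divfK.
exists (Sub (FracField.tofrac Q' / FracField.tofrac D) yA : A); apply: val_inj.
by rewrite /= mulrA -rmorphM QQ' divff.
Qed.

Lemma zA_inv k : exists y : A, zA R p k * y = 1.
Proof.
apply: (@polyA_inv _ ((\prod_(j < m | j != k) 'X_j) * Rpoly R m p)).
by rewrite mulrA /Dpoly [in RHS](bigD1 k).
Qed.

Lemma Rfactor_inv (t : {ffun 'I_m -> 'I_p}) : exists y : A,
  (1 - \sum_(j < m) zA R p j * (polyA p (zeta R p)%:MP) ^+ (t j).+1) * y = 1.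
Proof.
pose F (t : {ffun 'I_m -> 'I_p}) : {mpoly C[m]} :=
  1 - \sum_(j < m) (zeta R p ^+ (t j).+1)%:MP * 'X_j.
have [|y yE] := @polyA_inv (F t) ((\prod_(j < m) 'X_j) * \prod_(t' | t' != t) F t').
  by rewrite mulrCA /Dpoly /Rpoly [in RHS](bigD1 t).
exists y; rewrite -[RHS]yE; congr (_ * _).
rewrite /F rmorphB rmorph1 rmorph_sum; congr (_ - _); apply: eq_bigr => j _ /=.
by rewrite rmorphM mulrC rmorphXn /= rmorphXn.
Qed.

End CoefficientRing.

Theorem mainTheorem7 (R : realType) (m p : nat) (hp : (2 <= p)%N) (hm : (1 <= m)%N) :
  locally_free_quot (@Itilde R m p) (p ^ m).
Proof.
have p_gt0 : (0 < p)%N := ltnW hp.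
pose w : Aring R m p := polyA p (zeta R p)%:MP.
have w1 : w ^+ p = 1.
  by rewrite /w -rmorphXn -rmorphXn /= zeta_unity // !rmorph1.
have w_geom j : (0 < j < p)%N -> \sum_(i < p) w ^+ (j * i) = 0.
  move=> jp; transitivity (polyA p (\sum_(i < p) zeta R p ^+ (j * i))%:MP_[m]).
    rewrite !rmorph_sum; apply: eq_bigr => i _ /=.
    by rewrite !rmorphXn.
  by rewrite zeta_geom // !rmorph0.
pose pinv : Aring R m p := polyA p (p%:R^-1)%:MP.
have pinvK : pinv * p%:R = 1.
  have -> : p%:R = polyA p (p%:R)%:MP_[m] :> Aring R m p.
    by rewrite (rmorph_nat (@mpolyC m R[i])) (rmorph_nat (@polyA R m p)).
  transitivity (polyA p ((p%:R^-1)%:MP_[m] * (p%:R)%:MP_[m] : {mpoly R[i][m]})).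
    by rewrite [RHS]rmorphM.
  rewrite -mpolyCM mulVf; first by rewrite mpolyC1 rmorph1.
  by rewrite pnatr_eq0 -lt0n.
have [ginv ginvK] := fin_all_exists (@Rfactor_inv R m p).
have [zi ziK] := fin_all_exists (@zA_inv R m p).
have -> : @Itilde R m p = scaled_fermat_ideal p (zA R p) by [].
rewrite (scaled_fermat_idealE p ziK).
exact: (fermat_quotient_locally_free (z := zA R p) p_gt0 w1 w_geom pinvK ginvK).
Qed.
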